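(* Let $n$ be a positive integer and $\sigma$ a uniformly random permutation of $\{1,\ldots,n\}$. (i) If $a\ge2$ is an integer with $2a-1<n$, then $\Pr[D_{a,a-1}(\sigma)=0]<\frac1n$. (ii) If $a\ge3$ is an integer with $2a-2<n$, then $\Pr[D_{a,a-2}(\sigma)=0]\le\frac1{2(n-1)}$.
   Context: For positive integers $a,b$ with $a+b<n$ and a permutation $\sigma$ of $\{1,\ldots,n\}$, define $D_{a,b}(\sigma)=\sum_{i=1}^{a}\sigma(i)-\sum_{i=a+1}^{a+b}\sigma(i)$. *)

(* Defs.v *)
From mathcomp Require Import all_boot all_order all_algebra all_fingroup.
Set Implicit Arguments.
Unset Strict Implicit.
Unset Printing Implicit Defensive.
Import GRing.Theory Num.Theory.
Local Open Scope ring_scope.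

Definition uniform_prob (T : finType) (A : {set T}) : rat :=
  #|A|%:R / #|T|%:R.

(* A permutation s of {1,...,n} is encoded as s : 'S_n on {0,...,n-1}: the
   1-based position i + 1 carries the 1-based value (s i).+1.  The values must
   be shifted explicitly because D is not shift-invariant when a != b. *)
Definition D (n a b : nat) (s : 'S_n) : int :=
  \sum_(i < n | (i < a)%N) (s i).+1%:Z
  - \sum_(i < n | (a <= i < a + b)%N) (s i).+1%:Z.

(* Main.v *)
Require Import Defs.
From mathcomp Require Import all_boot all_order all_algebra all_fingroup.
From mathcomp Require Import zify ring.
Set Implicit Arguments.
Unset Strict Implicit.
Unset Printing Implicit Defensive.
Import GRing.Theory Num.Theory.
Local Open Scope ring_scope.

(* Adding 1 to all values modulo n changes D by a - b modulo n, so double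
   counting over the n shifts of a permutation bounds the number of s with
   n | D s.  Negating all values modulo n turns D = 0 into
   D = n * (a - b + w), where w is 1, -1 or 0 according to the block that holds
   the value n.  For a - b = 2 this is a nonzero multiple of n, so at most half
   of the s with n | D s have D s = 0.  When n is even, the double count also
   needs Pr[D even] <= n / (2 (n - 1)): the sums
   S_k = \sum_s \prod_(i < k) (-1)^(s i) satisfy
   (k + 1) S_k + (n - k - 1) S_(k+2) = 0, hence |S_k| <= n! / (n - 1) for even k
   strictly between 0 and n.  For a - b = 1, strictness comes from a
   permutation with n | D s and the value n outside the second block: it or
   its negation has D <> 0. *)

(** * Position weights and residues of ordinals *)

Definition wt (a b i : nat) : int := (i < a)%N%:Z - (a <= i < a + b)%N%:Z.

Lemma D_wt n a b (s : 'S_n) : D a b s = \sum_(i < n) wt a b i * (s i).+1%:Z.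
Proof.
rewrite /D big_mkcond [X in _ - X]big_mkcond -sumrB; apply: eq_bigr => i _.
by rewrite /wt; case: ifP; case: ifP => _ _ /=; lia.
Qed.

Lemma sum_wt n a b : (a + b <= n)%N -> \sum_(i < n) wt a b i = a%:Z - b%:Z.
Proof.
elim: n a b => [|n IHn] a b le_n.
  by rewrite big_ord0; lia.
case: a le_n => [|a] le_n; last first.
  by rewrite big_ord_recl [X in _ + X](IHn a b) // /wt /=; lia.
case: b le_n => [|b] le_n.
  by rewrite big1 // => i _; rewrite /wt add0n ltn0 andbF.
rewrite big_ord_recl [X in _ + X](IHn 0%N b) // /wt /=; lia.
Qed.

Lemma dvdz_sub_ord n (i j : 'I_n) : (n %| i%:Z - j%:Z)%Z -> i = j.
Proof.
case/dvdzP=> q eq_ij; apply: val_inj => /=.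
have := ltn_ord i; have := ltn_ord j.
by case: (ltrgtP q 0) => [||q0]; last (rewrite q0 in eq_ij); nia.
Qed.

(** * Cyclic shift and reversal of the values *)

Section Shift.

Variables (m a b : nat).
Local Notation n := m.+1.
Implicit Types s : 'S_n.

Definition shift_perm : 'S_n := perm (bij_inj (@ordS_bij n)).
Definition rev_perm : 'S_n := perm (@rev_ord_inj n).

Lemma shift_permE (v : 'I_n) :
  (shift_perm v).+1%:Z = v.+1%:Z + 1 - n%:Z * (v == ord_max)%:Z.
Proof.
rewrite permE /=; case: eqP => [->|ne_v] /=; first by rewrite modnn; lia.
have lt_v : (v < m)%N.
  by rewrite ltn_neqAle -ltnS ltn_ord andbT; apply/eqP => eq_v; apply/ne_v/val_inj.
by rewrite modn_small ?ltnS //; lia.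
Qed.

Lemma rev_permE (v : 'I_n) : (rev_perm v).+1%:Z = n.+1%:Z - v.+1%:Z.
Proof. by rewrite permE /= subSS; have := ltn_ord v; lia. Qed.

Hypothesis le_n : (a + b <= n)%N.

(** Only the value n wraps around, so the error against adding 1 everywhere is n times the weight of
    its position. *)
Lemma D_shift s : D a b (s * shift_perm)%g =
  D a b s + (a%:Z - b%:Z) - n%:Z * wt a b (s^-1%g ord_max).
Proof.
rewrite !D_wt -(@sum_wt n) // -big_split /=.
rewrite (bigD1 (s^-1%g ord_max)) // [X in _ = X - _](bigD1 (s^-1%g ord_max)) //=.
rewrite permM shift_permE permKV eqxx mulr1.
rewrite (@eq_bigr _ _ _ _ _ _ _ (fun i : 'I_n => wt a b i * (s i).+1%:Z + wt a b i)).
  by ring.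
move=> i ne_i; rewrite permM shift_permE -(inj_eq (@perm_inj _ s^-1)) permK.
by rewrite (negPf ne_i) mulr0; ring.
Qed.

Lemma D_rev s :
  D a b (s * rev_perm)%g = n.+1%:Z * (a%:Z - b%:Z) - D a b s.
Proof.
rewrite !D_wt -(@sum_wt n) // mulr_sumr -sumrB; apply: eq_bigr => i _.
by rewrite permM rev_permE; ring.
Qed.

(* The composite sends the 1-based value v to n - v and fixes n. *)
Lemma D_opp s : D a b (s * shift_perm * rev_perm)%g =
  n%:Z * (a%:Z - b%:Z + wt a b (s^-1%g ord_max)) - D a b s.
Proof. by rewrite D_rev D_shift; ring. Qed.

Lemma D_shiftX s k :
  (n %| D a b (s * shift_perm ^+ k)%g)%Z
  = (n %| D a b s + k%:Z * (a%:Z - b%:Z))%Z.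
Proof.
elim: k s => [|k IHk] s; first by rewrite mulg1 mul0r addr0.
rewrite expgS mulgA IHk D_shift.
rewrite (_ : _ + _ = D a b s + k.+1%:Z * (a%:Z - b%:Z)
  + (- wt a b (s^-1%g ord_max)) * n%:Z); first by rewrite rpredDr ?dvdz_mull.
by rewrite -[k.+1]addn1 PoszD; ring.
Qed.

(** Each power of the shift permutes ['S_n], so both sides count the pairs (s, k) for which the
    k-fold shift of [s] has [D] divisible by n. *)
Lemma card_dvd_D : (n * #|[set s : 'S_n | (n %| D a b s)%Z]| =
  \sum_(s : 'S_n) #|[set k : 'I_n | (n %| (D a b s + k%:Z * (a%:Z - b%:Z))%R)%Z]|)%N.
Proof.
transitivity (\sum_(k < n) \sum_(s : 'S_n)
    nat_of_bool (n %| (D a b s + k%:Z * (a%:Z - b%:Z))%R)%Z)%N.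
  rewrite -{1}[n]card_ord -sum_nat_const; apply: eq_bigr => k _.
  rewrite -sum1_card big_mkcond [LHS](reindex_inj (mulIg (shift_perm ^+ k)%g)) /=.
  by apply: eq_bigr => s _; rewrite inE D_shiftX; case: ifP.
rewrite exchange_big; apply: eq_bigr => s _.
by rewrite -sum1_card [RHS]big_mkcond; apply: eq_bigr => k _; rewrite inE; case: ifP.
Qed.

End Shift.

(** * Numbers of shifts that reach a multiple of n *)

Lemma card_dvd_add n (d : int) :
  (#|[set k : 'I_n | (n %| (d + k%:Z)%R)%Z]| <= 1)%N.
Proof.
apply/card_le1_eqP => i j; rewrite !inE => dvd_i dvd_j; apply: dvdz_sub_ord.
by rewrite (_ : _ - _ = d + j%:Z - (d + i%:Z)) ?rpredB //; ring.
Qed.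

Lemma card_dvd_add_double_odd n (d : int) : odd n ->
  (#|[set k : 'I_n | (n %| (d + k%:Z * 2)%R)%Z]| <= 1)%N.
Proof.
move=> odd_n; apply/card_le1_eqP => i j; rewrite !inE => dvd_i dvd_j.
apply: dvdz_sub_ord; rewrite -(@Gauss_dvdzl _ _ 2).
  by rewrite (_ : _ * _ = d + j%:Z * 2 - (d + i%:Z * 2)) ?rpredB //; ring.
by rewrite coprimezE /= coprimen2.
Qed.

(** Solutions exist only for even [d]; they agree modulo h, so each half of the range contains at
    most one. *)
Lemma card_dvd_add_double_even h (d : int) :
  (#|[set k : 'I_h.*2 | (h.*2 %| (d + k%:Z * 2)%R)%Z]| <= (2 %| d)%Z.*2)%N.
Proof.
have eh : h.*2%:Z = h%:Z * 2 by lia.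
have [_|ndvd_d] := boolP (2 %| d)%Z; last first.
  rewrite leqn0 cards_eq0; apply/eqP/setP => k; rewrite !inE.
  apply: contraNF ndvd_d => /dvdzP[q eq_q].
  by apply/dvdzP; exists (q * h%:Z - k%:Z); rewrite [X in q * X]eh in eq_q; lia.
rewrite -[(true.*2)%N]card_bool.
apply: (@leq_card_in _ _ (fun k : 'I_h.*2 => (k < h)%N)).
move=> i j; rewrite !inE => /dvdzP[q eq_q] /dvdzP[r eq_r] eq_ij.
apply: val_inj => /=.
have := ltn_ord i; have := ltn_ord j.
have : i%:Z - j%:Z = (q - r) * h%:Z by rewrite [X in q * X]eh in eq_q; rewrite [X in r * X]eh in eq_r; lia.
case: (ltrgtP (q - r) 0) => [||->]; nia.
Qed.

(** * Sign sums over permutations and their size *)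

Section SignSum.

Variables (n : nat) (e : 'I_n -> int).
Hypotheses (e_sqr : forall v, e v * e v = 1) (sum_e : \sum_v e v = 0).

Definition sign_sum k : int := \sum_(s : 'S_n) \prod_(i < n | (i < k)%N) e (s i).

(* Expand [0 = \sum_s (\prod_(i <= k) e (s i)) * (\sum_j e (s j))]: the terms
   with j <= k cancel a factor, the others add one. *)
Lemma sign_sum_rec k : (k.+2 <= n)%N ->
  k.+1%:Z * sign_sum k + (n%:Z - k.+1%:Z) * sign_sum k.+2 = 0.
Proof.
move=> lt_k.
pose F j := \sum_(s : 'S_n) (\prod_(i < n | (i < k.+1)%N) e (s i)) * e (s j).
have sumF : \sum_j F j = 0.
  rewrite exchange_big big1 // => s _; rewrite -mulr_sumr.
  by move: sum_e; rewrite (reindex_inj (@perm_inj _ s)) => ->; rewrite mulr0.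
have Flt (j : 'I_n) : (j < k.+1)%N -> F j = sign_sum k.
  move=> lt_j; pose p := Ordinal (ltnW lt_k).
  rewrite /F (reindex_inj (mulgI (tperm j p))) /=.
  apply: eq_bigr => s _; rewrite (bigD1 j) //= mulrC mulrA e_sqr mul1r.
  rewrite [RHS](reindex_inj (@perm_inj _ (tperm j p))).
  apply: eq_big => [i|i _]; last by rewrite permM.
  rewrite -val_eqE /=; case: tpermP => [->|->|/eqP ne_j /eqP ne_p].
  - by rewrite eqxx andbF ltnn.
  - by rewrite /=; lia.
  by rewrite -!val_eqE /= in ne_j ne_p *; lia.
have Fge (j : 'I_n) : (k < j)%N -> F j = sign_sum k.+2.
  move=> lt_j; pose p := Ordinal lt_k.
  rewrite /F (reindex_inj (mulgI (tperm j p))); apply: eq_bigr => s _ /=.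
  rewrite [RHS](bigD1 p) //= mulrC permM tpermL; congr (_ * _).
  apply: eq_big => [i|i lt_i]; first by rewrite -val_eqE /=; lia.
  by rewrite permM tpermD // -val_eqE /=; lia.
have -> : n%:Z = \sum_(j < n) 1 by rewrite sumr_const card_ord natz.
have -> : k.+1%:Z = \sum_(j < n) wt k.+1 0 j.
  by rewrite sum_wt ?addn0 ?subr0 // ltnW.
apply: etrans sumF; rewrite -sumrB !mulr_suml -big_split /=.
apply: eq_bigr => j _; have -> : wt k.+1 0 j = (j < k.+1)%N by rewrite /wt; lia.
have [lt_j|ge_j] := ltnP j k.+1; first by rewrite Flt // subrr mul1r mul0r addr0.
by rewrite Fge // subr0 mul1r mul0r add0r.
Qed.

Lemma sign_sum0 : sign_sum 0 = #|{: 'S_n}|%:Z.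
Proof.
by rewrite /sign_sum (eq_bigr (fun=> 1)) ?sumr_const ?natz // => s _; rewrite big1.
Qed.

Lemma abs_sign_sum_full : `|sign_sum n|%N = #|{: 'S_n}|.
Proof.
have -> : sign_sum n = (\prod_v e v) * #|{: 'S_n}|%:Z.
  rewrite -[#|_|%:Z]natz mulr_natr -sumr_const; apply: eq_bigr => s _.
  rewrite [RHS](reindex_inj (@perm_inj _ s)).
  by apply: eq_bigl => i; rewrite ltn_ord.
rewrite abszM.
have -> : `|(\prod_v e v)%R|%N = 1%N; last by rewrite mul1n.
elim/big_ind: _ => // [x y x1 y1|v _]; first by rewrite abszM x1 y1.
by have := e_sqr v; nia.
Qed.

End SignSum.

(** The step from 0 to 1 supplies the factor 1 / (n - 1). A later step from i to i + 1 has ratio (2i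
    + 1) / (n - 2i - 1), which is at most 1 exactly when 4(i + 1) <= n + 2. *)
Lemma ratio_rec_bound n F (f : nat -> nat) :
  (forall j, (j.*2.+2 <= n)%N -> (j.*2.+1 * f j = (n - j.*2.+1) * f j.+1)%N) ->
  f 0 = F -> forall j, (0 < j)%N -> (j.*2.*2 <= n + 2)%N -> (j.*2 <= n)%N ->
  ((n - 1) * f j <= F)%N.
Proof.
move=> f_rec f0; elim=> // -[|j] IHj _ le_j le_j'.
  by have := f_rec 0%N; rewrite f0 mul1n => <-.
apply: leq_trans (IHj _ _ _) => //; [|lia..].
rewrite leq_mul2l; apply/orP; right.
by have := f_rec j.+1 ltac:(lia); nia.
Qed.

Lemma abs_sign_sum_le n (e : 'I_n -> int) h j :
  (forall v, e v * e v = 1) -> \sum_v e v = 0 -> n = h.*2 -> (0 < j < h)%N ->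
  ((n - 1) * `|sign_sum e j.*2| <= #|{: 'S_n}|)%N.
Proof.
move=> e_sqr sum_e def_n /andP[j_gt0 lt_j].
have S_rec k : (k.+2 <= n)%N ->
    (k.+1 * `|sign_sum e k| = (n - k.+1) * `|sign_sum e k.+2|)%N.
  by move=> le_k; have := sign_sum_rec e_sqr sum_e le_k; nia.
have [le_j|gt_j] := leqP j.*2.*2 (n + 2).
  apply: (@ratio_rec_bound n _ (fun i => `|sign_sum e i.*2|%N)) => //; last by lia.
    by move=> i /S_rec.
  by rewrite sign_sum0.
(* Past the middle, run the recursion down from k = n, where the sum again has absolute value n!. *)
have -> : j.*2 = (n - (h - j).*2)%N by lia.
apply: (@ratio_rec_bound n _ (fun i => `|sign_sum e (n - i.*2)|%N)); try lia.
  move=> i le_i; have := S_rec (n - i.*2.+2)%N ltac:(lia).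
  have -> : (n - i.*2.+2).+2 = (n - i.*2)%N by lia.
  have -> : ((n - (n - i.*2.+2).+1) = i.*2.+1)%N by lia.
  have -> : ((n - i.*2.+2).+1 = n - i.*2.+1)%N by lia.
  by rewrite doubleS => ->.
by rewrite subn0 abs_sign_sum_full.
Qed.

(** * How often [D] is even *)

Lemma sum_altsign h : \sum_(v < h.*2) (-1) ^+ v.+1 = 0 :> int.
Proof.
elim: h => [|h IHh]; first by rewrite big_ord0.
by rewrite doubleS !big_ord_recr /= IHh !exprS; ring.
Qed.

(** Modulo 2 the signs do not matter: the plain sum minus [D] is twice the sum over the second
    block. *)
Lemma even_D_sum n a b (s : 'S_n) :
  (2 %| D a b s)%Z -> ~~ odd (\sum_(i < n | (i < a + b)%N) (s i).+1).
Proof.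
move=> dvd_D; rewrite -dvdn2 -[(2 %| _)%N]/(2 %| Posz _)%Z.
rewrite -[X in (_ %| X)%Z]natz natr_sum.
rewrite -(subrK (D a b s) (\sum_(i < n | _) _)) rpredD // D_wt big_mkcond -sumrB.
apply: rpred_sum => i _; apply/dvdzP.
exists ((a <= i < a + b)%N%:Z * (s i).+1%:Z).
by rewrite /wt; have [] := ltnP i a; have [] := ltnP i (a + b); rewrite ?natz /=; lia.
Qed.

Lemma card_even_D n a b h j : n = h.*2 -> (a + b = j.*2)%N -> (0 < j < h)%N ->
  (2 * ((n - 1) * #|[set s : 'S_n | (2 %| D a b s)%Z]|) <= n * #|{: 'S_n}|)%N.
Proof.
move=> def_n def_j lt_j.
pose e (v : 'I_n) : int := (-1) ^+ v.+1.
have e_sqr v : e v * e v = 1 by rewrite -expr2 sqrr_sign.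
have sum_e : \sum_v e v = 0 by rewrite /e def_n sum_altsign.
have := abs_sign_sum_le e_sqr sum_e def_n lt_j.
(* Pointwise, twice the indicator of even [D] is at most 1 plus the parity sign of the sum of the
   first a + b values. *)
suff : 2 * #|[set s : 'S_n | (2 %| D a b s)%Z]|%:Z <= #|{: 'S_n}|%:Z + sign_sum e j.*2.
  by move: (sign_sum e _) (#|_|) (#|_|) => S E N; nia.
rewrite -!natz -!sum1_card !natr_sum mulr_sumr big_mkcond -big_split /=.
apply: ler_sum => s _; rewrite inE prodrXr -signr_odd -def_j.
case: ifP => [/even_D_sum/negPf->//|_].
by case: (odd _).
Qed.

(** * Zeros of [D] among its multiples of n *)

Lemma card_D_eq0_double m a b : (a + b <= m.+1)%N -> a = b.+2 ->
  (2 * #|[set s : 'S_m.+1 | D a b s == 0]| <=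
     #|[set s : 'S_m.+1 | (m.+1 %| D a b s)%Z]|)%N.
Proof.
move=> le_n def_a; set Z := [set s | D a b s == 0].
pose f (s : 'S_m.+1) := (s * (shift_perm m * rev_perm m))%g.
have f_inj : injective f by apply: mulIg.
have Df s : s \in Z -> exists2 c : int, 0 < c & D a b (f s) = c * m.+1%:Z.
  rewrite inE => /eqP D0; rewrite /f mulgA D_opp // D0 subr0 mulrC.
  (* Here c = 2 + w, where the weight w of the position holding n is at least -1. *)
  by eexists; last by []; rewrite /wt; lia.
have -> : (2 * #|Z| = #|Z :|: f @: Z|)%N.
  rewrite cardsU card_imset // (_ : Z :&: _ = set0) ?cards0; first by lia.
  apply/setP => t; rewrite in_set0; apply/negP => /setIP[Zt /imsetP[s Zs def_t]].
  move: Zt; rewrite inE def_t; have [c c_gt0 ->] := Df s Zs; lia.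
apply/subset_leq_card/subsetP => t /setUP[|/imsetP[s Zs ->]]; rewrite !inE.
  by move/eqP->; rewrite dvdz0.
by have [c _ ->] := Df s Zs; rewrite dvdz_mull.
Qed.

(** * A nonzero multiple of n when a - b = 1 *)

Lemma shift_permX m k (v : 'I_m.+1) :
  (m.+1 %| ((shift_perm m ^+ k)%g v)%:Z - v%:Z - k%:Z)%Z.
Proof.
elim: k => [|k IHk]; first by rewrite perm1 subrr.
have := shift_permE ((shift_perm m ^+ k)%g v); rewrite expgSr permM => eq_v.
set w := shift_perm m _ in eq_v *.
set u := (shift_perm m ^+ k)%g v in IHk eq_v *.
rewrite (_ : _ - _ = u%:Z - v%:Z - k%:Z + (- (u == ord_max)%:Z) * m.+1%:Z).
  by rewrite rpredD ?dvdz_mull.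
by move: eq_v; case: (u == _); lia.
Qed.

(** The last position has weight 0, so all that counts is that n replaces i + 1 at a position of
    weight 1. *)
Lemma D_tperm_max m a b (i : 'I_m.+1) : (a + b <= m)%N -> (i < a)%N ->
  D a b (tperm i ord_max) = D a b (1%g : 'S_m.+1) + m%:Z - i%:Z.
Proof.
move=> le_m lt_i; apply/eqP; rewrite -subr_eq0; apply/eqP.
rewrite !D_wt (bigD1 i) //= [X in _ - (X + _ - _)](bigD1 i) //=.
rewrite tpermL perm1 (eq_bigr (fun j : 'I_m.+1 => wt a b j * ((1%g : 'S_m.+1) j).+1%:Z)).
  have wt_i : wt a b i = 1 by rewrite /wt; lia.
  by rewrite wt_i !mul1r /=; move: (\sum_(_ | _) _); lia.
move=> j ne_j; have [->|ne_max] := eqVneq j ord_max.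
  by have -> : wt a b (@ord_max m) = 0 by [rewrite /wt /=; lia]; rewrite !mul0r.
by rewrite perm1 tpermD // eq_sym.
Qed.

(* Otherwise, for each i < c.+2, swapping the values at i and at the last
   position and then shifting until n divides D puts the value n at a position
   of the second block; mod n this position is affine in i, so c.+2 positions
   would embed in c.+1. *)
Lemma exists_dvd_D_wt m c : (c.+2 + c.+1 <= m)%N -> exists2 s : 'S_m.+1,
  (m.+1 %| D c.+2 c.+1 s)%Z & 0 <= wt c.+2 c.+1 (s^-1%g ord_max).
Proof.
move=> le_m; set a := c.+2; set b := c.+1; set n := m.+1.
pose t (i : 'I_n) : 'S_n := tperm i ord_max.
(* Since a - b = 1, each shift adds 1 to [D] modulo n, so this many shifts make it divisible. *)
pose k i := `|(- D a b (t i)) %% n|%Z%N.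
have def_k i : (n %| D a b (t i) + (k i)%:Z)%Z.
  rewrite /k gez0_abs ?modz_ge0 // addrC; apply/dvdz_mod0P.
  by rewrite modzDml addNr mod0z.
pose s i := (t i * shift_perm m ^+ k i)%g.
have dvd_s i : (n %| D a b (s i))%Z.
  rewrite /s D_shiftX; last by rewrite /a /b /n; lia.
  by rewrite (_ : a%:Z - b%:Z = 1) ?mulr1 // /a /b; lia.
have [/existsP[i wt_i]|/existsPn wt_lt0] :=
  boolP [exists i, 0 <= wt a b ((s i)^-1%g ord_max)]; first by exists (s i).
pose f i := (s i)^-1%g ord_max.
have f_bound i : (a <= f i < a + b)%N.
  by have := wt_lt0 i; rewrite -/(f i) /wt; lia.
have f_mod (i : 'I_n) : (i < a)%N ->
    (n %| m%:Z - (f i)%:Z + (D a b (1%g : 'S_n) + m%:Z - i%:Z))%Z.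
  (* The position [f i] is neither [i] nor the last one, so [t i] fixes it, and [k i] shifts carry
     the value there to the top one. *)
  move=> lt_i; have := shift_permX (k i) (t i (f i)); rewrite -permM permKV.
  rewrite [t i _]tpermD -?val_eqE /=; try by have := f_bound i; lia.
  rewrite -D_tperm_max // => dvd_f.
  rewrite (_ : _ + _ = m%:Z - (f i)%:Z - (k i)%:Z + (D a b (t i) + (k i)%:Z)).
    by rewrite rpredD.
  by rewrite /t; ring.
have le_a : (a <= n)%N by rewrite /a /n; lia.
(* By [f_bound] the offset into the second block is below b, so [inord] never returns its
   default. *)
pose g (i : 'I_a) : 'I_b := inord (f (widen_ord le_a i) - a).
have g_inj : injective g.
  move=> i j; rewrite /g; set i' := widen_ord le_a i; set j' := widen_ord le_a j.
  have fi := f_bound i'; have fj := f_bound j'.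
  move=> /(congr1 val); rewrite /= !inordK; try by rewrite /a /b in fi fj *; lia.
  move=> eq_f; have eq_fij : f i' = f j' :> nat by lia.
  suff [] : i' = j' by move=> ?; apply: val_inj.
  apply: dvdz_sub_ord.
  have := rpredB (f_mod j' (ltn_ord j)) (f_mod i' (ltn_ord i)).
  by rewrite eq_fij /= (_ : _ - _ = i%:Z - j%:Z) //; ring.
by have := leq_card g g_inj; rewrite !card_ord ltnn.
Qed.

Lemma exists_dvd_D_neq0 m c : (c.+2 + c.+1 <= m)%N -> exists2 s : 'S_m.+1,
  (m.+1 %| D c.+2 c.+1 s)%Z & D c.+2 c.+1 s != 0.
Proof.
move=> le_m; have [s dvd_s wt_s] := exists_dvd_D_wt le_m.
have [D0|] := eqVneq (D c.+2 c.+1 s) 0; last by exists s.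
(* By [D_opp] the new value is n * (1 + w) with w >= 0. *)
exists (s * shift_perm m * rev_perm m)%g; rewrite D_opp ?D0 ?subr0; try by lia.
by rewrite dvdz_mulr.
Qed.

(** * From counts to probabilities *)

Theorem theorem4 (n : nat) (hn : (0 < n)%N) :
  (forall a : nat, (2 <= a)%N -> (2 * a - 1 < n)%N ->
     uniform_prob [set s : 'S_n | D a (a - 1) s == 0] < 1 / n%:R)
  /\
  (forall a : nat, (3 <= a)%N -> (2 * a - 2 < n)%N ->
     uniform_prob [set s : 'S_n | D a (a - 2) s == 0]
       <= 1 / (2 * (n%:R - 1))).
Proof.
have N_gt0 : (0 < #|{: 'S_n}|)%N by apply/card_gt0P; exists 1%g.
case: n hn N_gt0 => // m _ N_gt0; split=> a a_ge lt_a; rewrite /uniform_prob.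
  have [c def_a def_b] : exists2 c, a = c.+2 & (a - 1 = c.+1)%N by exists (a - 2)%N; lia.
  rewrite def_b def_a.
  have le_n : (c.+2 + c.+1 <= m.+1)%N by lia.
  have [t dvd_t ne_t] := @exists_dvd_D_neq0 m c ltac:(lia).
  have lt_Z : (#|[set s : 'S_m.+1 | D c.+2 c.+1 s == 0]| <
      #|[set s : 'S_m.+1 | (m.+1 %| D c.+2 c.+1 s)%Z]|)%N.
    apply: proper_card; apply/properP; split; last by exists t; rewrite inE.
    by apply/subsetP => s; rewrite !inE => /eqP->; rewrite dvdz0.
  have le_Z : (m.+1 * #|[set s : 'S_m.+1 | (m.+1 %| D c.+2 c.+1 s)%Z]| <= #|{: 'S_m.+1}|)%N.
    rewrite card_dvd_D // -sum1_card; apply: leq_sum => s _.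
    rewrite (_ : c.+2%:Z - c.+1%:Z = 1); last by lia.
    by under eq_finset do rewrite mulr1; apply: card_dvd_add.
  rewrite ltr_pdivrMr ?ltr0n // mulrAC mul1r ltr_pdivlMr ?ltr0n // -natrM ltr_nat.
  by apply: leq_trans le_Z; rewrite mulnC ltn_pmul2l.
have def_a : a = (a - 2).+2 by lia.
have le_n : (a + (a - 2) <= m.+1)%N by lia.
have le_Z := card_D_eq0_double le_n def_a.
have dif2 : a%:Z - (a - 2)%N%:Z = 2 by lia.
have := card_dvd_D le_n; rewrite dif2 => eq_Z.
suff bnd : (2 * m * #|[set s : 'S_m.+1 | D a (a - 2) s == 0]| <= #|{: 'S_m.+1}|)%N.
  have -> : m.+1%:R - 1 = m%:R :> rat by rewrite -natr1 addrK.
  rewrite ler_pdivrMr ?ltr0n // mulrAC mul1r.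
  rewrite ler_pdivlMr -?natrM ?ltr0n ?ler_nat; last by lia.
  by rewrite mulnC.
have [odd_n|even_n] := boolP (odd m.+1).
  (* For odd n at most one shift works, which yields the stronger bound 1 / (2n). *)
  have : (m.+1 * #|[set s : 'S_m.+1 | (m.+1 %| D a (a - 2) s)%Z]| <= #|{: 'S_m.+1}|)%N.
    rewrite eq_Z -sum1_card; apply: leq_sum => s _.
    exact: card_dvd_add_double_odd.
  by apply: leq_trans; rewrite -mulnA mulnCA leq_mul.
have def_n : m.+1 = (m.+1)./2.*2 by rewrite even_halfK.
have : (m.+1 * #|[set s : 'S_m.+1 | (m.+1 %| D a (a - 2) s)%Z]|
    <= 2 * #|[set s : 'S_m.+1 | (2 %| D a (a - 2) s)%Z]|)%N.
  rewrite eq_Z -[#|[set s | _]|]sum1_card big_distrr /= [X in (_ <= X)%N]big_mkcond.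
  apply: leq_sum => s _; rewrite inE.
  have := card_dvd_add_double_even (m.+1)./2 (D a (a - 2) s); rewrite -def_n.
  by case: (2 %| _)%Z.
have := @card_even_D m.+1 a (a - 2) (m.+1)./2 (a - 1) def_n ltac:(lia) ltac:(lia).
(* With Z the zeros of [D] and m = n - 1, multiply by n and chain 2 m n #Z <= m n #{n | D} <= 2 m
   #{D even} <= n n!. *)
rewrite subn1 /= => le_N le_E; rewrite -(leq_pmul2l (ltn0Sn m)).
apply: leq_trans le_N; rewrite mulnCA (mulnC 2%N m) -mulnA [leqRHS]mulnCA leq_mul2l.
by apply/orP; right; apply: leq_trans le_E; rewrite mulnCA leq_mul.
Qed.
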